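(* The orthogonal retraction $R_u(\xi_u):=\psi(u+\xi_u)$, $u\in\mathcal{M}$, $\xi_u\in T_u\mathcal{M}$ (defined for $u+\xi_u\in\Omega$), is a well-defined retraction on $\mathcal{M}$. That is, $R$ is a well-defined smooth map into $\mathcal{M}$ on the open neighborhood $\{(u,\xi_u)\in T\mathcal{M} : u+\xi_u\in\Omega\}$ of the zero section, and for every $u\in\mathcal{M}$: (i) $R_u(0_u)=u$; (ii) $\mathrm{D}R_u(0_u)=\mathrm{id}_{T_u\mathcal{M}}$.
   Context: Let $F\ge 1$ be an integer, $n$ a positive even integer, $N=2n(2F+1)$, and let $M$ be a real number with $0\le M<F$ and $M\notin\mathbb{Z}$. Vectors $w\in\mathbb{R}^N$ are written in blocks $w=(w_F;w_{F-1};\dots;w_{-F})$ with $w_l\in\mathbb{R}^{2n}$, the index $l$ ranging over the integers from $-F$ to $F$. Define $$\mathcal{M}=\Big\{u\in\mathbb{R}^N : \sum_{l=-F}^F\|u_l\|_2^2=1,\ \sum_{l=-F}^F l\,\|u_l\|_2^2=M\Big\},$$ a closed embedded submanifold of $\mathbb{R}^N$ of dimension $N-2$, with tangent space $T_u\mathcal{M}=\{\xi\in\mathbb{R}^N : \sum_l u_l^T\xi_l=0,\ \sum_l l\,u_l^T\xi_l=0\}$, and let $$\Omega=\Big\{w\in\mathbb{R}^N : \sum_{l<M}\|w_l\|_2^2>0,\ \sum_{l>M}\|w_l\|_2^2>0\Big\},$$ an open set containing $\mathcal{M}$. For $w\in\Omega$, $\psi(w)\in\mathcal{M}$ is defined by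 $\psi(w)_l=\sigma_l w_l$, $l=F,\dots,-F$, where $\sigma_F,\dots,\sigma_{-F}$ are positive real coefficients (depending on $w$) satisfying $$\sum_{l=-F}^F\|w_l\|_2^2\sigma_l^2=1,\qquad \sum_{l=-F}^F l\,\|w_l\|_2^2\sigma_l^2=M,$$ $$\sigma_{l-1}\sigma_{l+1}=\sigma_l^2\quad(l=1,\dots,F-1),\qquad \sigma_l\sigma_{-l}=\sigma_0^2\quad(l=1,\dots,F).$$ A retraction on $\mathcal{M}$ is a smooth mapping $R$ from the tangent bundle $T\mathcal{M}$ (here: from a neighborhood of its zero section) to $\mathcal{M}$ such that, with $R_u$ the restriction of $R$ to $T_u\mathcal{M}$ and $0_u$ the zero of $T_u\mathcal{M}$, $R_u(0_u)=u$ and, under the canonical identification $T_{0_u}T_u\mathcal{M}\simeq T_u\mathcal{M}$, $\mathrm{D}R_u(0_u)=\mathrm{id}_{T_u\mathcal{M}}$. *)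

(* Defs.v *)
From HB Require Import structures.
From mathcomp Require Import all_boot all_order all_algebra.
From mathcomp Require Import all_classical all_reals all_analysis.
Set Implicit Arguments.
Unset Strict Implicit.
Unset Printing Implicit Defensive.
Import Order.TTheory GRing.Theory Num.Theory.
Import numFieldNormedType.Exports.
Local Open Scope classical_set_scope.
Local Open Scope ring_scope.

(* [f] is of class C^k on the open set [U] (between finite-dimensional spaces:
   all iterated directional derivatives up to order [k] exist and are
   continuous). *)
Fixpoint class_C (R : realType) (V W : normedModType R) (k : nat)
    (U : set V) (f : V -> W) : Prop :=
  match k with
  | 0 => forall x, U x -> {for x, continuous f}
  | k'.+1 => (forall x, U x -> differentiable f x) /\
             (forall v : V, class_C k' U (fun x => 'D_v f x))
  end.

Definition smooth_open (R : realType) (V W : normedModType R)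
    (U : set V) (f : V -> W) : Prop := forall k : nat, class_C k U f.

(* Smoothness on an arbitrary subset [S] (e.g. an embedded submanifold) of an
   ambient space: locally, [f] is the restriction of a C^oo map defined on an
   open set of the ambient space. *)
Definition smooth_on (R : realType) (V W : normedModType R)
    (S : set V) (f : V -> W) : Prop :=
  forall p, S p -> exists (U : set V) (g : V -> W),
    [/\ open U, U p, smooth_open U g & forall x, U x -> S x -> f x = g x].

(* [L] is the Frechet differential at [x] of the restriction of [f] to the
   affine subspace [x + E], where [E] is a linear subspace and [L] is linear
   on [E]. *)
Definition is_diff_along (R : realType) (V W : normedModType R)
    (E : set V) (f : V -> W) (x : V) (L : V -> W) : Prop :=
  forall e : R, 0 < e ->
    \forall h \near within E (nbhs (0 : V)),
      `|f (x + h) - f x - L h| <= e * `|h|.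

Definition tangent_bundle (V : Type) (X : set V) (T : V -> set V) :
    set (V * V) := [set p | X p.1 /\ T p.1 p.2].

(* [Ret] is a retraction, defined on [D], on the submanifold [X] of [V] with
   tangent spaces [T u]: [D] is an open neighbourhood of the zero section of
   the tangent bundle, [Ret] maps [D] smoothly into [X], [Ret_u 0 = u], and the
   differential of [Ret_u] at [0] is the identity of [T u]. *)
Definition is_retraction (R : realType) (V : normedModType R)
    (X : set V) (T : V -> set V) (D : set (V * V)) (Ret : V -> V -> V) : Prop :=
  [/\ exists2 O : set (V * V), open O & D = tangent_bundle X T `&` O,
      forall u, X u -> D (u, 0),
      (forall u xi, D (u, xi) -> X (Ret u xi)) /\
        smooth_on D (fun p => Ret p.1 p.2),
      forall u, X u -> Ret u 0 = u
    & forall u, X u -> is_diff_along (T u) (Ret u) 0 id].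

(* R^N with N = 2n(2F+1): row [i] of the matrix is the block [w_l] with
   [l = F - i], so that the rows are w_F, w_{F-1}, ..., w_{-F}. *)
Notation bvec R F n := 'M[R]_((2 * F).+1, 2 * n).

Definition lvl (F : nat) (i : 'I_(2 * F).+1) : int := F%:Z - (i : nat)%:Z.

(* Row holding the block of index [l], meaningful for -F <= l <= F. *)
Definition blk (F : nat) (l : int) : 'I_(2 * F).+1 := inord `|F%:Z - l|%N.

Lemma lvl_blk (F : nat) (l : int) : - F%:Z <= l <= F%:Z -> lvl (blk F l) = l.
Proof.
case/andP=> hl hu; rewrite /lvl /blk inordK.
  by rewrite gez0_abs ?subr_ge0 // opprB addrC subrK.
rewrite ltnS -lez_nat gez0_abs ?subr_ge0 // mul2n -addnn PoszD.
by rewrite lerD2l lerNl.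
Qed.

Section Spinor.
Variables (R : realType) (F n : nat) (M : R).

Definition bdot (u v : bvec R F n) (i : 'I_(2 * F).+1) : R :=
  \sum_(j < 2 * n) u i j * v i j.

Definition sqnorm (w : bvec R F n) (i : 'I_(2 * F).+1) : R :=
  \sum_(j < 2 * n) w i j ^+ 2.

Definition manifold : set (bvec R F n) :=
  [set u | \sum_i sqnorm u i = 1 /\ \sum_i (lvl i)%:~R * sqnorm u i = M].

Definition tangent (u : bvec R F n) : set (bvec R F n) :=
  [set xi | \sum_i bdot u xi i = 0 /\ \sum_i (lvl i)%:~R * bdot u xi i = 0].

Definition Omega : set (bvec R F n) :=
  [set w | 0 < \sum_(i | (lvl i)%:~R < M) sqnorm w i /\
           0 < \sum_(i | M < (lvl i)%:~R) sqnorm w i].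

Definition is_scaling (w : bvec R F n) (s : 'I_(2 * F).+1 -> R) : Prop :=
  [/\ forall i, 0 < s i,
      \sum_i sqnorm w i * s i ^+ 2 = 1,
      \sum_i (lvl i)%:~R * sqnorm w i * s i ^+ 2 = M,
      forall l : int, 1 <= l <= F%:Z - 1 ->
        s (blk F (l - 1)) * s (blk F (l + 1)) = s (blk F l) ^+ 2
    & forall l : int, 1 <= l <= F%:Z ->
        s (blk F l) * s (blk F (- l)) = s (blk F 0) ^+ 2].

(* Junk value when no scaling exists, i.e. possibly outside [Omega M]. *)
Definition scaling (w : bvec R F n) : 'I_(2 * F).+1 -> R :=
  get [set s | is_scaling w s].

Definition psi (w : bvec R F n) : bvec R F n :=
  \matrix_(i, j) (scaling w i * w i j).

Definition retr_dom : set (bvec R F n * bvec R F n) :=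
  [set p | tangent_bundle manifold tangent p /\ Omega (p.1 + p.2)].

Definition orth_retr (u xi : bvec R F n) : bvec R F n := psi (u + xi).

End Spinor.

(* Main.v *)
Require Import Defs.
From HB Require Import structures.
From mathcomp Require Import all_boot all_order all_algebra.
From mathcomp Require Import zify ring.
From mathcomp Require Import all_classical all_reals all_analysis.
Import Order.TTheory GRing.Theory Num.Theory.
Import numFieldNormedType.Exports.
Local Open Scope classical_set_scope.
Local Open Scope ring_scope.
Set Implicit Arguments.
Unset Strict Implicit.
Unset Printing Implicit Defensive.

(** Taking logarithms, the relations [s_(l-1) s_(l+1) = s_l ^+ 2] and
    [s_l s_(-l) = s_0 ^+ 2] say that [ln s_l] is affine in [l], so that
    [s_l ^+ 2 = A * exp (l x)] for two unknowns [A > 0] and [x].  Write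
    [a_l = |w_l|^2], [c_l = l - M] and [S(x) = \sum_l a_l exp (c_l x)].  After
    absorbing a factor [exp (M x)] into [A], the normalization reads
    [A S(x) = 1], and the moment equation minus [M] times the normalization
    reads [S'(x) = 0].  The function [S] is strictly convex, and on [Omega] its
    derivative takes both signs because weight is present on both sides of [M];
    hence there is exactly one such [x] ([dexpsum_root], [dexpsum_inj]), and
    [s_l = exp ((c_l x - ln S(x)) / 2)] is the only scaling ([is_scalingP]).

    Smoothness of [psi] reduces to that of the root [x] as a function of [w],
    a scalar implicit function problem.  The increment of [S'] between two
    points factors as the increment of the argument times a positive continuous
    function ([dexpsum_quotE]).  This exhibits the increment of the root as a
    differentiable function vanishing at the base point times a function which
    is merely continuous there, and such a product is differentiable
    ([is_diff_scale_vanishing]).  The derivative is a quotient of exponential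
    sums evaluated at the root itself, so [C^k] regularity of the root yields
    [C^(k+1)] regularity ([class_C_root]).

    At a point [u] of the manifold the root is [0] and [S(0) = 1], so all the
    coefficients are [1].  For a tangent vector [h], the two equations of the
    tangent space state that the derivatives along [h] of [\sum_l c_l |u_l|^2]
    and of [\sum_l |u_l|^2] vanish; these are the numerators of the derivatives
    of the root and of [ln S].  The coefficients are therefore stationary along
    [h], and the derivative of [psi] along [h] is [1 * h]. *)

(** * Frechet differentials and functions of class C^k *)

Section Differential.
Context {R : realType} {V W : normedModType R}.
Implicit Types (f g : V -> W) (x v : V).

Lemma is_diff_epsilon f (df : {linear V -> W}) x : continuous df ->
  (forall e : R, 0 < e -> \forall h \near (0 : V),
     `|f (h + x) - f x - df h| <= e * `|h|) ->
  is_diff x f df.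
Proof.
move=> cdf fdf.
have fE : f \o shift x = cst (f x) + df +o_ (0 : V) id.
  apply/eqaddoP => e e0; near=> h; rewrite opprD addrA.
  by near: h; exact: fdf.
have dE := diff_unique cdf fE.
by apply: DiffDef => //; apply/diff_locallyP; rewrite dE.
Unshelve. all: by end_near. Qed.

Lemma differentiable_epsilon f x : differentiable f x ->
  forall e : R, 0 < e -> \forall h \near (0 : V),
     `|f (h + x) - f x - 'd f x h| <= e * `|h|.
Proof.
move=> /diff_locallyP[_ /eqaddoP fdf] e e0.
by near=> h; rewrite -addrA -opprD; near: h; exact: fdf.
Unshelve. all: by end_near. Qed.

Lemma near_eq_is_diff f g x :
  {near x, f =1 g} -> differentiable f x -> is_diff x g ('d f x).
Proof.
move=> fg df; apply: is_diff_epsilon => [|e e0]; first exact: diff_continuous.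
have fgx := nbhs_singleton fg.
have : \forall h \near (0 : V), f (h + x) = g (h + x).
  have: \forall h \near x, f h = g h by [].
  by rewrite (near_shift 0) /= subr0.
move: (differentiable_epsilon df e0).
by apply: filterS2 => h + <-; rewrite -fgx.
Unshelve. all: by end_near. Qed.

(** In the expansion of [k y *: g y] at a zero of [g], the variation of [k] is
    multiplied by [g y = O(y - x)], so continuity of [k] is enough to make that
    term negligible. *)
Lemma is_diff_scale_vanishing (k : V -> R) g x :
  {for x, continuous k} -> differentiable g x -> g x = 0 ->
  is_diff x (fun y => k y *: g y) (k x \*: 'd g x).
Proof.
move=> ck dg gx0.
have cdg : continuous ('d g x) := diff_continuous dg.
apply: is_diff_epsilon => [y|e e0]; first exact: continuousZl_tmp.
rewrite gx0 scaler0.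
have [C C0 dgC] := linear_lipschitz cdg.
have e1 : 0 < e / 2 / C by rewrite !divr_gt0.
have ck0 : k (h + x) @[h --> (0 : V)] --> k x.
  have : {for 0, continuous (k \o (fun h => h + x))}.
    apply: continuous_comp; last by rewrite /= add0r.
    by apply: cvgD; [exact: cvg_id|exact: cvg_cst].
  by rewrite /prop_for /continuous_at /= add0r.
have kb : \forall h \near (0 : V), `|k (h + x)| <= `|k x| + 1.
  have /cvgrPdist_le /(_ 1 ltr01) := ck0.
  apply: filterS => h kh; rewrite -lerBlDl; apply: le_trans kh.
  by rewrite distrC lerB_dist.
have e2 : 0 < e / 2 / (`|k x| + 1) by rewrite !divr_gt0// ltr_wpDl.
have /cvgrPdist_le /(_ _ e1) := ck0.
move: (differentiable_epsilon dg e2) kb.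
apply: filterS3 => h; rewrite gx0 subr0 => gh kh kxh.
have -> : k (h + x) *: g (h + x) - 0 - k x *: 'd g x h =
   k (h + x) *: (g (h + x) - 'd g x h) - (k x - k (h + x)) *: 'd g x h.
  by rewrite subr0 scalerBr scalerBl opprB addrA subrK.
apply: le_trans (ler_normB _ _) _; rewrite !normrZ.
rewrite [e in leRHS]splitr mulrDl lerD//.
  apply: le_trans (ler_pM _ _ kh gh) _ => //.
  by rewrite mulrA [X in X * _]mulrC divfK// gt_eqF// ltr_wpDl.
apply: le_trans (ler_pM _ _ kxh (dgC h)) _ => //.
by rewrite mulrA divfK ?gt_eqF.
Unshelve. all: by end_near. Qed.

Lemma derive_comp1 (f : V -> R) (phi : R -> R) (d : R) x v :
  differentiable f x -> is_derive (f x) 1 phi d ->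
  differentiable (phi \o f) x /\ 'D_v (phi \o f) x = 'D_v f x * d.
Proof.
move=> df dphi.
have dphi' : differentiable phi (f x) by apply/derivable1_diffP.
have dc : differentiable (phi \o f) x by exact: differentiable_comp.
split=> //; rewrite !deriveE// diff_comp//= diff1E// derive1E.
by rewrite (@derive_val _ _ _ _ _ _ _ dphi).
Qed.

End Differential.

Section ClassC.
Context {R : realType} {V : normedModType R}.
Implicit Types (U : set V).

Lemma class_CW (W : normedModType R) k U (f : V -> W) :
  class_C k.+1 U f -> class_C k U f.
Proof.
elim: k f => [|k IH] f [df Df].
  by move=> x /df /differentiable_continuous.
by split=> // v; exact/IH/Df.
Qed.

(** The closure properties below compute directional derivatives by formulas
    that hold only on [U]; this lemma carries regularity across such
    identities. *)
Lemma class_C_ext (W : normedModType R) k U (f g : V -> W) :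
  open U -> {in U, f =1 g} -> class_C k U f -> class_C k U g.
Proof.
move=> oU; elim: k f g => [|k IH] f g fg.
  move=> Cf x Ux; have nfg : {near x, f =1 g}.
    by near=> y; apply: fg; rewrite inE; near: y; exact: open_nbhs_nbhs.
  have := Cf x Ux; rewrite /prop_for /continuous_at -(nbhs_singleton nfg).
  by apply: cvg_trans; apply: near_eq_cvg.
move=> [df Df]; have nfg x : U x -> {near x, f =1 g}.
  move=> Ux; near=> y; apply: fg; rewrite inE; near: y.
  exact: open_nbhs_nbhs.
split=> [x Ux|v].
  by have [] := near_eq_is_diff (nfg x Ux) (df x Ux).
by apply: IH (Df v) => x; rewrite inE => Ux; exact/near_eq_derive/nfg.
Unshelve. all: by end_near. Qed.

Lemma class_C_cst (W : normedModType R) k U (c : W) : class_C k U (cst c).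
Proof.
elim: k c => [|k IH] c; first by move=> x _; exact: cst_continuous.
split=> [x _|v]; first exact: differentiable_cst.
by rewrite (_ : (fun x => _) = cst 0)//; apply/funext => x; rewrite derive_cst.
Qed.

Lemma class_CD (W : normedModType R) k U (f g : V -> W) : open U ->
  class_C k U f -> class_C k U g -> class_C k U (fun x => f x + g x).
Proof.
move=> oU; elim: k f g => [|k IH] f g.
  by move=> Cf Cg x Ux; apply: continuousD; [exact: Cf|exact: Cg].
move=> [df Df] [dg Dg]; split=> [x Ux|v].
  by apply: differentiableD; [exact: df|exact: dg].
apply: class_C_ext (IH _ _ (Df v) (Dg v)) => // x; rewrite inE => Ux /=.
by rewrite -deriveD//; apply: diff_derivable; [exact: df|exact: dg].
Qed.

Lemma class_C_sum (W : normedModType R) (I : Type) (r : seq I) (P : pred I) k U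
    (f : I -> V -> W) : open U -> (forall i, class_C k U (f i)) ->
  class_C k U (fun x => \sum_(i <- r | P i) f i x).
Proof.
move=> oU Cf; elim: r => [|i r IH].
  rewrite (_ : (fun x => _) = cst 0); first exact: class_C_cst.
  by apply/funext => x; rewrite big_nil.
have [Pi|nPi] := boolP (P i).
  rewrite (_ : (fun x => _) = fun x => f i x + \sum_(j <- r | P j) f j x).
    exact: class_CD.
  by apply/funext => x; rewrite big_cons Pi.
rewrite (_ : (fun x => _) = fun x => \sum_(j <- r | P j) f j x)//.
by apply/funext => x; rewrite big_cons (negbTE nPi).
Qed.

(** The Leibniz rule expresses the derivative through [f] and [g] as well as
    their derivatives, hence the weakening [class_CW] inside the induction; the
    same pattern recurs for the exponential and the inverse. *)
Lemma class_CM k U (f g : V -> R) : open U ->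
  class_C k U f -> class_C k U g -> class_C k U (fun x => f x * g x).
Proof.
move=> oU; elim: k f g => [|k IH] f g.
  by move=> Cf Cg x Ux; apply: continuousM; [exact: Cf|exact: Cg].
move=> CSf CSg; have Cf := class_CW CSf; have Cg := class_CW CSg.
have [[df Df] [dg Dg]] := (CSf, CSg).
split=> [x Ux|v].
  by apply: differentiableM; [exact: df|exact: dg].
apply: class_C_ext (class_CD oU (IH _ _ Cf (Dg v)) (IH _ _ Cg (Df v))) => //.
move=> x; rewrite inE => Ux /=.
rewrite [RHS]deriveM; first by [].
  by apply: diff_derivable; exact: df.
by apply: diff_derivable; exact: dg.
Qed.

Lemma class_CZl (W : normedModType R) k U (f : V -> R) (w : W) : open U ->
  class_C k U f -> class_C k U (fun x => f x *: w).
Proof.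
move=> oU; elim: k f => [|k IH] f.
  by move=> Cf x Ux; apply: continuousZr_tmp; exact: Cf.
move=> [df Df]; split=> [x Ux|v]; first by apply: differentiableZl; exact: df.
apply: class_C_ext (IH _ (Df v)) => // x; rewrite inE => Ux /=.
have dfx := df x Ux.
by rewrite !deriveE// ?diffZl//; exact: differentiableZl.
Qed.

Lemma class_C_expR k U (f : V -> R) : open U ->
  class_C k U f -> class_C k U (fun x => expR (f x)).
Proof.
move=> oU; elim: k f => [|k IH] f.
  by move=> Cf x Ux; apply: continuous_comp; [exact: Cf|exact: continuous_expR].
move=> CSf; have [df Df] := CSf.
have dexp x v (Ux : U x) := derive_comp1 v (df x Ux) (is_derive_expR (f x)).
split=> [x Ux|v]; first by have [] := dexp x 0 Ux.
apply: class_C_ext (class_CM oU (Df v) (IH _ (class_CW CSf))) => // x.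
by rewrite inE => Ux; have [_ <-] := dexp x v Ux.
Qed.

Lemma class_CV k U (f : V -> R) : open U -> (forall x, U x -> f x != 0) ->
  class_C k U f -> class_C k U (fun x => (f x)^-1).
Proof.
move=> oU f0; elim: k => [|k IH].
  by move=> Cf x Ux; apply: continuousV; [exact: f0|exact: Cf].
move=> CSf; have [df Df] := CSf; have Cg := IH (class_CW CSf).
split=> [x Ux|v]; first by apply: differentiableV; [exact: df|exact: f0].
have C1 := class_CM oU (@class_C_cst _ k U (-1 : R)) (class_CM oU Cg Cg).
apply: class_C_ext (class_CM oU C1 (Df v)) => // x.
rewrite inE => Ux; rewrite deriveV ?f0//; last exact/diff_derivable/df.
by rewrite /cst mulN1r -expr2 exprVn.
Qed.

Lemma class_C_ln k U (f : V -> R) : open U -> (forall x, U x -> 0 < f x) ->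
  class_C k U f -> class_C k U (fun x => ln (f x)).
Proof.
move=> oU f0; case: k => [|k].
  move=> Cf x Ux; apply: continuous_comp; first exact: Cf.
  by apply: continuous_ln; exact: f0.
move=> CSf; have [df Df] := CSf.
have dln x v (Ux : U x) := derive_comp1 v (df x Ux) (is_derive1_ln (f0 x Ux)).
split=> [x Ux|v]; first by have [] := dln x 0 Ux.
have CV : class_C k U (fun x => (f x)^-1).
  by apply: class_CV (class_CW CSf) => // x /f0 ?; rewrite gt_eqF.
apply: class_C_ext (class_CM oU (Df v) CV) => // x.
by rewrite inE => Ux; have [_ <-] := dln x v Ux.
Qed.

(** The directional derivative of [f \o A] along [v] is that of [f] along
    [A v], composed with [A], by mere rewriting of the difference quotient. *)
Lemma class_C_comp_linear (V' W : normedModType R) k U (f : V -> W)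
    (A : {linear V' -> V}) : continuous A ->
  class_C k U f -> class_C k (A @^-1` U) (f \o A).
Proof.
move=> cA; elim: k f => [|k IH] f.
  by move=> Cf x /= Ux; apply: continuous_comp; [exact: cA|exact: Cf].
move=> [df Df]; split=> [x /= Ux|v].
  by apply: differentiable_comp; [exact: linear_differentiable|exact: df].
have -> : (fun x => 'D_v (f \o A) x) = (fun y => 'D_(A v) f y) \o A.
  apply/funext => x; rewrite /derive/=.
  suff -> : (fun h : R => h^-1 *: (f (A (h *: v + x)) - f (A x))) =
     (fun h : R => h^-1 *: (f (h *: A v + A x) - f (A x))) by [].
  by apply/funext => h; rewrite (linearD A) (linearZZ A).
exact: IH (Df (A v)).
Qed.

Lemma smooth_differentiable (W : normedModType R) U (f : V -> W) x :
  smooth_open U f -> U x -> differentiable f x.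
Proof. by move=> Cf Ux; have [df _] := Cf 1%N; exact: df. Qed.

Lemma smooth_is_derive (W : normedModType R) U (f : V -> W) x v :
  smooth_open U f -> U x -> is_derive x v f ('D_v f x).
Proof.
move=> Cf Ux; apply: derivableP; apply: diff_derivable.
exact: smooth_differentiable Cf Ux.
Qed.

End ClassC.

Lemma is_derive_coord {R : realType} m n (w v : 'M[R]_(m, n)) i j :
  is_derive w v (fun u : 'M[R]_(m, n) => u i j : R) (v i j).
Proof.
apply: DeriveDef; first exact/diff_derivable/differentiable_coord.
have dv : derivable (@id 'M[R]_(m, n)) w v by exact: derivable_id.
have /(congr1 (fun A : 'M[R]_(m, n) => A i j)) := derive_mx dv.
by rewrite derive_id mxE.
Qed.

Lemma class_C_coord {R : realType} m n (U : set 'M[R]_(m, n)) k i j :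
  class_C k U (fun w : 'M[R]_(m, n) => w i j : R).
Proof.
case: k => [w _|k]; first exact: coord_continuous.
split=> [w _|v]; first exact: differentiable_coord.
rewrite (_ : (fun w => _) = cst (v i j)); first exact: class_C_cst.
apply/funext => w.
exact: (@derive_val _ _ _ _ _ _ _ (is_derive_coord w v i j)).
Qed.

Lemma class_C_mx {R : realType} {V : normedModType R} m n (U : set V) k
    (f : 'I_m -> 'I_n -> V -> R) : open U ->
  (forall i j, class_C k U (f i j)) ->
  class_C k U (fun w => \matrix_(i, j) f i j w).
Proof.
move=> oU Cf.
rewrite (_ : (fun w => _) =
    fun w => \sum_i \sum_j f i j w *: (delta_mx i j : 'M[R]_(m, n))).
  by apply: class_C_sum => // i; apply: class_C_sum => // j; exact: class_CZl.
apply/funext => w; rewrite [LHS]matrix_sum_delta.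
by apply: eq_bigr => i _; apply: eq_bigr => j _; rewrite mxE.
Qed.

Lemma is_derive_sum_seq {R : realType} {V W : normedModType R} {I : Type}
    (r : seq I) (h : I -> V -> W) (dh : I -> W) (x v : V) :
  (forall i, is_derive x v (h i) (dh i)) ->
  is_derive x v (fun u => \sum_(i <- r) h i u) (\sum_(i <- r) dh i).
Proof.
move=> Dh; elim: r => [|i r IH].
  rewrite big_nil (_ : (fun u => _) = cst 0); first exact: is_derive_cst.
  by apply/funext => u; rewrite big_nil.
rewrite big_cons (_ : (fun u => _) = h i + (fun u => \sum_(j <- r) h j u)).
  exact: is_deriveD.
by apply/funext => u; rewrite big_cons.
Qed.

(** * Exponential sums *)

Section ExpQuotient.
Context {R : realType}.
Implicit Types (c x y d : R).

(** The difference quotient at [0] of [fun d => expR (c * d)], extended by its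
    limit [c] at [d = 0]. *)
Definition exp_quot c d : R := if d == 0 then c else (expR (c * d) - 1) / d.

Lemma exp_quotE c x y :
  expR (c * y) - expR (c * x) = (y - x) * (expR (c * x) * exp_quot c (y - x)).
Proof.
rewrite /exp_quot; case: eqP => [/eqP|/eqP yx].
  by rewrite subr_eq0 => /eqP->; rewrite !subrr mul0r.
rewrite mulrCA [(y - x) * _]mulrC divfK// mulrBr mulr1 -expRD -mulrDr.
by rewrite [x + _]addrC subrK.
Qed.

(** [c * exp_quot c d] has the sign of [(c * d) * (expR (c * d) - 1)], a product
    of two factors of the same sign. *)
Lemma exp_quot_gt0 c d : c != 0 -> 0 < c * exp_quot c d.
Proof.
move=> c0; rewrite /exp_quot; case: eqP => [_|/eqP d0].
  by rewrite -expr2 exprn_even_gt0.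
have cd0 : c * d != 0 by rewrite mulf_neq0.
have -> : c * ((expR (c * d) - 1) / d) = (c * d) * (expR (c * d) - 1) / d ^+ 2.
  by field.
rewrite divr_gt0// ?exprn_even_gt0//.
have [cd_lt0|cd_gt0|cdE] := ltrgt0P (c * d).
- by rewrite pmulr_rgt0// subr_gt0 expR_gt1.
- by rewrite nmulr_rgt0// subr_lt0 expR_lt1.
- by rewrite cdE eqxx in cd0.
Qed.

Lemma continuous_exp_quot c : {for 0, continuous (exp_quot c)}.
Proof.
rewrite /prop_for /continuous_at {2}/exp_quot eqxx.
have [dc Dc] : differentiable (expR \o ( *%R c)) (0 : R) /\
    'D_1 (expR \o ( *%R c)) (0 : R) = 'D_1 ( *%R c) (0 : R) * expR (c * 0).
  by apply: derive_comp1; exact: (@ex_diff _ _ _ _ _ _ _ (is_diff_scaler c 0)).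
have cE : 'D_1 ( *%R c) (0 : R) = c.
  rewrite (_ : *%R c = c *: (@idfun R)) ?deriveZ// derive_id.
  exact: mulr1.
apply/cvgrPdist_le => e e0.
have := differentiable_epsilon dc e0.
apply: filterS => h; rewrite /exp_quot; case: eqP => [->|/eqP h0].
  by move=> _; rewrite subrr normr0 ltW.
rewrite /= addr0 mulr0 expR0.
have -> : 'd (expR \o ( *%R c)) 0 h = c * h.
  rewrite -[h in LHS]mulr1 -[h * 1]/(h *: (1 : R)) linearZZ -deriveE// Dc cE.
  by rewrite mulr0 expR0 mulr1 [RHS]mulrC.
move=> H; rewrite distrC -(@ler_pM2r _ `|h|) ?normr_gt0// -normrM mulrBl.
by rewrite divfK.
Qed.

End ExpQuotient.

Section ExpSum.
Context {R : realType} {I : finType}.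
Implicit Types (c a : I -> R) (x y : R).

Definition expsum c a x : R := \sum_i a i * expR (c i * x).

(** The derivative of [expsum c a], which is again an exponential sum. *)
Definition dexpsum c a : R -> R := expsum c (fun i => c i * a i).

(** Nonnegativity makes [expsum c a] convex; one positive weight at a nonzero
    exponent makes it positive and strictly convex. *)
Definition admissible c a : Prop :=
  (forall i, 0 <= a i) /\ (exists2 i, c i != 0 & 0 < a i).

(** The slope of [dexpsum c a] between [x] and [x + d]; at [d = 0] it is the
    second derivative of [expsum c a]. *)
Definition dexpsum_quot c a x d : R :=
  \sum_i a i * (expR (c i * x) * (c i * exp_quot (c i) d)).

Lemma dexpsum_quotE c a x y :
  dexpsum c a y - dexpsum c a x = (y - x) * dexpsum_quot c a x (y - x).
Proof.
rewrite /dexpsum /expsum -sumrB mulr_sumr; apply: eq_bigr => i _.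
by rewrite -mulrBr exp_quotE; ring.
Qed.

Lemma dexpsum_quot_gt0 c a x d : admissible c a -> 0 < dexpsum_quot c a x d.
Proof.
move=> [a0 [i ci ai]]; rewrite /dexpsum_quot (bigD1 i)//=.
rewrite ltr_wpDr//.
  2: by rewrite mulr_gt0// mulr_gt0 ?expR_gt0// exp_quot_gt0.
apply: sumr_ge0 => j _; rewrite mulr_ge0// mulr_ge0 ?expR_ge0//.
have [->|cj] := eqVneq (c j) 0; first by rewrite mul0r.
exact/ltW/exp_quot_gt0.
Qed.

Lemma dexpsum_mono c a : admissible c a -> {mono dexpsum c a : x y / x < y}.
Proof.
move=> ca; apply/leW_mono/le_mono => x y xy.
by rewrite -subr_gt0 dexpsum_quotE mulr_gt0 ?subr_gt0// dexpsum_quot_gt0.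
Qed.

Lemma dexpsum_inj c a : admissible c a -> injective (dexpsum c a).
Proof.
move=> ca x y xy; apply/eqP; case: ltgtP => //; rewrite -(dexpsum_mono ca);
  by rewrite xy ltxx.
Qed.

Lemma expsum_gt0 c a x : admissible c a -> 0 < expsum c a x.
Proof.
move=> [a0 [i ci ai]]; rewrite /expsum (bigD1 i)//= ltr_wpDr//.
  by apply: sumr_ge0 => j _; rewrite mulr_ge0 ?expR_ge0.
by rewrite mulr_gt0 ?expR_gt0.
Qed.

Lemma continuous_expsum c a : continuous (expsum c a).
Proof.
move=> x; apply: cvg_big => [|i _]; first exact: add_continuous.
apply: cvgMl_tmp; apply: continuous_comp; last exact: continuous_expR.
exact: mulrl_continuous.
Qed.

(** For [x >= 0] the terms with positive exponent grow at least linearly, by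
    [1 + t <= expR t], and the negative terms only increase; so [dexpsum c a]
    lies above an affine function of positive slope [P]. *)
Lemma dexpsum_ge0_ex c a : (forall i, 0 <= a i) -> 0 < \sum_(i | 0 < c i) a i ->
  exists2 x, 0 <= x & 0 <= dexpsum c a x.
Proof.
move=> a0 ca.
pose P := \sum_(i | 0 < c i) c i ^+ 2 * a i.
have P0 : 0 < P.
  have [i ci ai] : exists2 i, 0 < c i & 0 < a i.
    apply: contrapT => H; move: ca; rewrite big1 ?ltxx// => i ci.
    apply/le_anti; rewrite a0 andbT leNgt; apply/negP => ai.
    by apply: H; exists i.
  rewrite /P (bigD1 i)//= ltr_wpDr//; last by rewrite mulr_gt0// exprn_gt0.
  by apply: sumr_ge0 => j /andP[_ _]; rewrite mulr_ge0// sqr_ge0.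
(* the affine minorant [dexpsum c a 0 + x * P] is nonnegative there *)
pose x := `|dexpsum c a 0| / P.
have x0 : 0 <= x by rewrite divr_ge0// ltW.
exists x => //; apply: (@le_trans _ _ (dexpsum c a 0 + x * P)).
  by rewrite /x divfK ?gt_eqF// -lerBlDl sub0r -normrN ler_norm.
rewrite /dexpsum /expsum /P mulr_sumr big_mkcond [X in _ + X]big_mkcond/=.
rewrite -big_split/=; apply: ler_sum => i _; rewrite mulr0 expR0 mulr1.
case: ltP => ci.
  apply: le_trans (ler_wpM2l _ (expR_ge1Dx (c i * x))).
    by rewrite mulrDr mulr1 lerD2l (_ : x * _ = c i * a i * (c i * x))//; ring.
  by rewrite mulr_ge0// ltW.
rewrite addr0 -subr_ge0 -[X in _ - X]mulr1 -mulrBr mulr_le0 ?mulr_le0_ge0//.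
by rewrite subr_le0 expR_le1 mulr_le0_ge0.
Qed.

(** A point where the sum is nonpositive comes from [dexpsum_ge0_ex] by the
    reflection [c |-> - c], which turns [dexpsum c a x] into
    [- dexpsum c a (- x)]. *)
Lemma dexpsum_root c a : (forall i, 0 <= a i) ->
  0 < \sum_(i | c i < 0) a i -> 0 < \sum_(i | 0 < c i) a i ->
  exists x, dexpsum c a x = 0.
Proof.
move=> a0 ca_lt ca_gt.
have [y y0 Gy] := dexpsum_ge0_ex a0 ca_gt.
have [] := @dexpsum_ge0_ex (fun i => - c i) a a0.
  by under eq_bigl do rewrite oppr_gt0.
move=> z z0 Gz.
have {}Gz : dexpsum c a (- z) <= 0.
  rewrite -oppr_ge0; apply: le_trans Gz _; rewrite /dexpsum /expsum -sumrN.
  by apply: ler_sum => i _; rewrite !mulrN !mulNr.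
have zy : - z <= y by apply: le_trans y0; rewrite oppr_le0.
have [||x _ xE] := @IVT R (dexpsum c a) (- z) y 0 zy; last by exists x.
  exact/continuous_subspaceT/continuous_expsum.
by rewrite ge_min le_max Gz Gy orbT.
Qed.

End ExpSum.

(** The scalar implicit function theorem for the equation [dexpsum = 0].  The
    dependence on the unknown is explicit, so only functions of the parameter
    are ever differentiated, never functions of the pair. *)
Section ImplicitRoot.
Context {R : realType} {V : normedModType R} {I : finType}.
Variables (c : I -> R) (a : I -> V -> R) (U : set V) (X : V -> R).
Hypothesis oU : open U.
Hypothesis Ca : forall i, smooth_open U (a i).
Hypothesis ca : forall w, U w -> admissible c (a ^~ w).
Hypothesis X0 : forall w, U w -> dexpsum c (a ^~ w) (X w) = 0.

Lemma class_C_expsum k (b : I -> V -> R) (x : V -> R) :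
  (forall i, class_C k U (b i)) -> class_C k U x ->
  class_C k U (fun w => expsum c (b ^~ w) (x w)).
Proof.
move=> Cb Cx; apply: class_C_sum => // i; apply: class_CM => //.
by apply: class_C_expR => //; apply: class_CM => //; exact: class_C_cst.
Qed.

Lemma class_C_dexpsum k (x : V -> R) : class_C k U x ->
  class_C k U (fun w => dexpsum c (a ^~ w) (x w)).
Proof.
move=> Cx; apply: (@class_C_expsum k (fun i w => c i * a i w)) => // i.
by apply: class_CM => //; [exact: class_C_cst|exact: Ca].
Qed.

(** Strict monotonicity traps the root: a sign change of [dexpsum] between
    [X w - e] and [X w + e] persists for nearby parameters. *)
Lemma continuous_root w : U w -> {for w, continuous X}.
Proof.
move=> Uw; apply/cvgrPdist_lt => e e0.
have cG x : {for w, continuous (fun w => dexpsum c (a ^~ w) x)}.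
  exact: (@class_C_dexpsum 0 (cst x) (@class_C_cst _ _ _ 0 _ _)).
have Gl : dexpsum c (a ^~ w) (X w - e) < 0.
  by rewrite -(X0 Uw) dexpsum_mono ?ltrBlDr ?ltrDl//; exact: ca.
have Gr : 0 < dexpsum c (a ^~ w) (X w + e).
  by rewrite -(X0 Uw) dexpsum_mono ?ltrDl//; exact: ca.
near=> v.
have Uv : U v by near: v; exact: open_nbhs_nbhs.
rewrite ltr_distlC -(dexpsum_mono (ca Uv)) -(dexpsum_mono (ca Uv) (X v)) X0//.
apply/andP; split; near: v.
  exact: (cvgr_lt _ (cG (X w - e))).
exact: (cvgr_gt _ (cG (X w + e))).
Unshelve. all: by end_near. Qed.

(** Since [dexpsum (a u) (X u) = 0], the factorization of increments gives
    [X u = X w - (K u)^-1 * g u], where [g u = dexpsum (a u) (X w)] has the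
    parameter varying and the argument fixed.  Continuity of [X] gives
    continuity of [K] at [w], and [g] is differentiable with [g w = 0]. *)
Lemma derive_root w v : U w -> differentiable X w /\
  'D_v X w = - dexpsum c (fun i => 'D_v (a i) w) (X w) /
             expsum c (fun i => c i ^+ 2 * a i w) (X w).
Proof.
move=> Uw; have cX := continuous_root Uw.
pose K u := dexpsum_quot c (a ^~ u) (X w) (X u - X w).
pose g u := dexpsum c (a ^~ u) (X w).
have dg : differentiable g w.
  apply: (@smooth_differentiable _ _ _ U) => // k.
  by apply: class_C_dexpsum; exact: class_C_cst.
have cK : {for w, continuous K}.
  apply: cvg_big => [|i _]; first exact: add_continuous.
  apply: cvgM; first exact: (Ca i 0%N w Uw).
  apply: cvgMl_tmp; apply: cvgMl_tmp.
  apply: (@continuous_comp _ _ _ (fun u => X u - X w)).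
    by apply: cvgB; [exact: cX|exact: cvg_cst].
  by rewrite /= subrr; exact: continuous_exp_quot.
have Kw : K w = expsum c (fun i => c i ^+ 2 * a i w) (X w).
  rewrite /K subrr; apply: eq_bigr => i _.
  by rewrite /exp_quot eqxx; ring.
have K0 u : U u -> 0 < K u by move=> Uu; exact/dexpsum_quot_gt0/ca.
have gw : g w = 0 by exact: X0.
have XE : {near w, (cst (X w) - (fun u => (K u)^-1 *: g u)) =1 X}.
  near=> u; have Uu : U u by near: u; exact: open_nbhs_nbhs.
  have := dexpsum_quotE c (a ^~ u) (X w) (X u).
  rewrite X0// sub0r -/(g u) -/(K u) => gE.
  have Ku : K u != 0 by rewrite gt_eqF ?K0.
  rewrite !fctE -[g u]opprK gE /GRing.scale/=; field.
  exact: Ku.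
have dk : is_diff w (fun u => (K u)^-1 *: g u) ((K w)^-1 \*: 'd g w).
  apply: is_diff_scale_vanishing => //.
  by apply: cvgV => //; rewrite gt_eqF// K0.
have dcg := is_diffB (is_diff_cst (X w) w) dk.
have dX := near_eq_is_diff XE (@ex_diff _ _ _ _ _ _ _ dcg).
split; first exact: ex_diff.
rewrite deriveE; last exact: ex_diff.
rewrite (@diff_val _ _ _ _ _ _ _ dX) (@diff_val _ _ _ _ _ _ _ dcg).
rewrite -Kw mulNr [in RHS]mulrC; rewrite !fctE /= sub0r; congr (- (_ * _)).
rewrite -deriveE//.
rewrite /g /dexpsum /expsum.
have Dg i : is_derive w v (fun u => c i * a i u * expR (c i * X w))
    (c i * 'D_v (a i) w * expR (c i * X w)).
  rewrite (_ : (fun u => _) = (c i * expR (c i * X w)) *: a i); last first.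
    by apply/funext => u; rewrite mulrAC.
  rewrite mulrAC; apply: is_deriveZ; apply: derivableP; apply: diff_derivable.
  exact: smooth_differentiable (Ca i) Uw.
exact: (@derive_val _ _ _ _ _ _ _ (is_derive_sum_seq _ Dg)).
Unshelve. all: by end_near. Qed.

(** Bootstrap: the derivative of [X] given by [derive_root] is an expression in
    [X] itself which is as regular as [X]. *)
Lemma class_C_root k : class_C k U X.
Proof.
elim: k => [|k IH]; first by move=> w; exact: continuous_root.
split=> [w Uw|v]; first by have [] := derive_root 0 Uw.
have C1 : class_C k U (fun w => dexpsum c (fun i => 'D_v (a i) w) (X w)).
  apply: (@class_C_expsum k (fun i w => c i * 'D_v (a i) w)) => // i.
  apply: class_CM => //; first exact: class_C_cst.
  by have [_] := Ca i k.+1; exact.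
have C2 : class_C k U (fun w => expsum c (fun i => c i ^+ 2 * a i w) (X w)).
  apply: (@class_C_expsum k (fun i w => c i ^+ 2 * a i w)) => // i.
  by apply: class_CM => //; [exact: class_C_cst|exact: Ca].
have C2' := class_CV oU _ C2.
have C3 := class_CM oU (@class_C_cst _ V _ k U (-1 : R)) C1.
apply: class_C_ext (class_CM oU C3 (C2' _)) => //.
  move=> w; rewrite inE => Uw; have [_ ->] := derive_root v Uw.
  by rewrite /cst mulN1r.
move=> w Uw; have [a0 [i ci ai]] := ca Uw.
rewrite gt_eqF//; apply: (@expsum_gt0 _ _ c); split=> [j|].
  by rewrite mulr_ge0// sqr_ge0.
by exists i => //; rewrite mulr_gt0// exprn_even_gt0.
Qed.

End ImplicitRoot.

(** * Solving the scaling equations *)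

(** A centre of mass located at [0], with no mass at [0], needs mass on the
    negative side. *)
Lemma sum_lt0_gt0 (R : realType) (I : finType) (c a : I -> R) :
  (forall i, c i != 0) -> (forall i, 0 <= a i) -> 0 < \sum_i a i ->
  \sum_i c i * a i = 0 -> 0 < \sum_(i | c i < 0) a i.
Proof.
move=> c0 a0 sa sca; rewrite lt_neqAle sumr_ge0// andbT eq_sym.
apply/eqP => sa0.
have a_lt0 i : c i < 0 -> a i = 0 by exact: (psumr_eq0P _ sa0).
have ca_ge0 i : 0 <= c i * a i.
  by have [/a_lt0->|ci] := ltP (c i) 0; rewrite ?mulr0// mulr_ge0.
have ca0 i : c i * a i = 0 by exact: (psumr_eq0P _ sca).
move: sa; rewrite big1 ?ltxx// => i _.
by have /eqP := ca0 i; rewrite mulf_eq0 (negbTE (c0 i)) => /eqP.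
Qed.

Lemma blk_lvl F (i : 'I_(2 * F).+1) : blk F (lvl i) = i.
Proof.
by apply/val_inj; rewrite /blk /lvl/= opprB addrC subrK absz_nat inordK.
Qed.

Lemma lvl_bounds F (i : 'I_(2 * F).+1) : - F%:Z <= lvl i <= F%:Z.
Proof. by rewrite /lvl; have := ltn_ord i; lia. Qed.

(** In logarithms the first relation is a linear recurrence which determines
    the levels [l >= 0] from levels [0] and [1], and the second one reflects
    them to the negative levels. *)
Lemma scaling_geometric (R : realType) (F : nat) (s : 'I_(2 * F).+1 -> R) :
  (forall i, 0 < s i) ->
  (forall l : int, 1 <= l <= F%:Z - 1 ->
     s (blk F (l - 1)) * s (blk F (l + 1)) = s (blk F l) ^+ 2) ->
  (forall l : int, 1 <= l <= F%:Z ->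
     s (blk F l) * s (blk F (- l)) = s (blk F 0) ^+ 2) ->
  exists y d : R, forall i, s i = expR (y + (lvl i)%:~R * d).
Proof.
move=> s0 sS sN; pose z l := ln (s (blk F l)).
have s0' i : s i \is Num.pos by rewrite posrE.
have zS l : 1 <= l <= F%:Z - 1 -> z (l - 1) + z (l + 1) = z l *+ 2.
  by move=> /sS; rewrite /z -lnXn// => <-; rewrite lnM.
have zN l : 1 <= l <= F%:Z -> z l + z (- l) = z 0 *+ 2.
  by move=> /sN; rewrite /z -lnXn// => <-; rewrite lnM.
have zP (k : nat) : (k <= F)%N -> z k%:Z = z 0 + k%:R * (z 1 - z 0).
  elim/ltn_ind: k => -[|[|k]] IH kF; first by rewrite mul0r addr0.
    by rewrite mul1r addrC subrK.
  have := zS k.+1%:Z; have -> : k.+1%:Z - 1 = k%:Z by lia.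
  have -> : k.+1%:Z + 1 = k.+2%:Z by lia.
  have IHk := IH k ltac:(lia) ltac:(lia).
  have IHk1 := IH k.+1 ltac:(lia) ltac:(lia).
  rewrite IHk IHk1 => /(_ ltac:(lia)).
  move=> E; apply: (addrI (z 0 + k%:R * (z 1 - z 0))).
  by rewrite E -[k.+2]addn2 -[k.+1]addn1 !natrD; ring.
exists (z 0), (z 1 - z 0) => i.
rewrite -[LHS](lnK (s0' i)) -[in LHS](blk_lvl i) -/(z _); congr expR.
have := lvl_bounds i; case: (lvl i) => k /andP[lk uk].
  by rewrite zP//; lia.
have := zN k.+1%:Z ltac:(lia).
rewrite NegzE zP; last by lia.
move=> E; apply: (addrI (z 0 + k.+1%:R * (z 1 - z 0))).
by rewrite E mulrNz; ring.
Qed.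

Section Scaling.
Context {R : realType} {F n : nat} (M : R).
Local Notation I := 'I_(2 * F).+1.
Local Notation bv := (bvec R F n).
Implicit Types (w u h : bv) (i : I) (s : I -> R) (x : R).

Definition shifted_lvl i : R := (lvl i)%:~R - M.
Local Notation c := shifted_lvl.

(** The denominator [expsum] enters through its logarithm so that the
    coefficient is a single exponential. *)
Definition exp_scaling w x i : R :=
  expR ((c i * x - ln (expsum c (sqnorm w) x)) / 2).

Lemma exp_scaling_sqr w x i : 0 < expsum c (sqnorm w) x ->
  exp_scaling w x i ^+ 2 = expR (c i * x) / expsum c (sqnorm w) x.
Proof.
move=> S0; rewrite -expRM_natl mulrC divfK// expRB lnK//.
Qed.

(** Starting from the affine form [y + l * d] of [ln s_l], the root is
    [x = 2 * d] because the equations involve [s_l ^+ 2]; shifting the levels by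
    [M] changes the constant [y] into [y + M * d]. *)
Lemma is_scalingP w s : admissible c (sqnorm w) -> is_scaling M w s <->
  exists2 x, dexpsum c (sqnorm w) x = 0 & s = exp_scaling w x.
Proof.
move=> wa; split=> [[s0 s1 sM sS sN]|[x Gx ->]]; last first.
  have S0 := expsum_gt0 x wa.
  have S1 : expsum c (sqnorm w) x != 0 by rewrite gt_eqF.
  have E (l : int) : - F%:Z <= l <= F%:Z -> exp_scaling w x (blk F l) =
     expR (((l%:~R - M) * x - ln (expsum c (sqnorm w) x)) / 2).
    by move=> lF; rewrite /exp_scaling /c lvl_blk.
  have sum1 : \sum_i sqnorm w i * exp_scaling w x i ^+ 2 = 1.
    under eq_bigr do rewrite exp_scaling_sqr// mulrA.
    by rewrite -mulr_suml -/(expsum _ _ _) divff.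
  split=> [i| | |l lF|l lF]; first exact: expR_gt0.
  - exact: sum1.
  - have : \sum_i c i * sqnorm w i * exp_scaling w x i ^+ 2 = 0.
      under eq_bigr do rewrite exp_scaling_sqr// mulrA.
      by rewrite -mulr_suml -/(expsum _ _ _) -/(dexpsum _ _ _) Gx mul0r.
    under eq_bigr do rewrite -mulrA mulrBl mulrA.
    by rewrite sumrB -mulr_sumr sum1 mulr1 => /eqP; rewrite subr_eq0 => /eqP.
  - rewrite !E; [|lia|lia|lia]; rewrite -expRM_natl -expRD; congr expR.
    by rewrite !rmorphD !rmorphN !rmorph1; field.
  - rewrite !E; [|lia|lia|lia]; rewrite -expRM_natl -expRD; congr expR.
    by rewrite mulrNz; field.
have [y [d sE]] := scaling_geometric s0 sS sN.
pose x := 2 * d; pose A := expR (2 * (y + M * d)).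
have s2 i : s i ^+ 2 = A * expR (c i * x).
  by rewrite sE -expRM_natl -expRD; congr expR; rewrite /x /c; ring.
have AS : A * expsum c (sqnorm w) x = 1.
  rewrite -s1 mulr_sumr; apply: eq_bigr => i _; rewrite s2; ring.
have AG : A * dexpsum c (sqnorm w) x = 0.
  transitivity (\sum_i (lvl i)%:~R * sqnorm w i * s i ^+ 2 -
    M * (\sum_i sqnorm w i * s i ^+ 2)).
    by rewrite !mulr_sumr -sumrB; apply: eq_bigr => i _; rewrite s2 /c; ring.
  by rewrite sM s1 mulr1 subrr.
exists x; first by move/eqP: AG; rewrite mulf_eq0 expR_eq0 => /eqP.
apply/funext => i; rewrite sE /exp_scaling; congr expR.
have -> : expsum c (sqnorm w) x = expR (- (2 * (y + M * d))).
  rewrite expRN -/A; apply: (mulfI (_ : A != 0)); first by rewrite expR_eq0.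
  by rewrite AS divff ?expR_eq0.
by rewrite expRK /x /c; field.
Qed.

Lemma sqnorm_ge0 w i : 0 <= sqnorm w i.
Proof. by apply: sumr_ge0 => j _; exact: sqr_ge0. Qed.

Lemma Omega_admissible w : Omega M w -> admissible c (sqnorm w).
Proof.
move=> [_ wM]; split=> [i|]; first exact: sqnorm_ge0.
apply: contrapT => H; move: wM; rewrite big1 ?ltxx// => i iM.
apply/le_anti; rewrite sqnorm_ge0 andbT leNgt; apply/negP => ai.
by apply: H; exists i => //; rewrite gt_eqF// subr_gt0.
Qed.

Definition multiplier w : R := get [set x | dexpsum c (sqnorm w) x = 0].

Lemma multiplierP w : Omega M w -> dexpsum c (sqnorm w) (multiplier w) = 0.
Proof.
move=> [wl wg]; have [||x Gx] := @dexpsum_root R _ c (sqnorm w) (sqnorm_ge0 w).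
- by under eq_bigl do rewrite subr_lt0.
- by under eq_bigl do rewrite subr_gt0.
exact: (@getPex _ [set x | dexpsum c (sqnorm w) x = 0] (ex_intro _ x Gx)).
Qed.

Lemma multiplier_unique w x : Omega M w -> dexpsum c (sqnorm w) x = 0 ->
  multiplier w = x.
Proof.
move=> Ow Gx; apply: (dexpsum_inj (Omega_admissible Ow)).
by rewrite multiplierP.
Qed.

Lemma is_scaling_unique w s : Omega M w ->
  is_scaling M w s <-> s = exp_scaling w (multiplier w).
Proof.
move=> Ow; rewrite (is_scalingP _ (Omega_admissible Ow)).
split=> [[x Gx ->]|->].
  by rewrite (multiplier_unique Ow Gx).
by exists (multiplier w) => //; exact: multiplierP.
Qed.

Lemma scalingE w : Omega M w -> scaling M w = exp_scaling w (multiplier w).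
Proof.
move=> Ow; apply/(is_scaling_unique _ Ow).
apply: (@getPex _ [set s | is_scaling M w s]).
by eexists; apply/is_scaling_unique.
Qed.

Lemma psi_manifold w : Omega M w -> manifold M (psi M w).
Proof.
move=> Ow; have [_ s1 sM _ _] : is_scaling M w (scaling M w).
  by apply/is_scaling_unique => //; exact: scalingE.
have E i : sqnorm (psi M w) i = sqnorm w i * scaling M w i ^+ 2.
  by rewrite /sqnorm mulr_suml; apply: eq_bigr => j _; rewrite mxE exprMn mulrC.
split; first by rewrite -[RHS]s1; apply: eq_bigr.
by rewrite -[RHS]sM; apply: eq_bigr => i _; rewrite E mulrA.
Qed.

End Scaling.

(** * Smoothness of the projection and its differential *)

Section Retraction.
Context {R : realType} {F n : nat} (M : R).
Local Notation I := 'I_(2 * F).+1.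
Local Notation bv := (bvec R F n).
Implicit Types (w u h : bv) (i : I).
Local Notation c := (shifted_lvl M).

Lemma shifted_moment u : manifold M u -> \sum_i c i * sqnorm u i = 0.
Proof.
move=> [u1 uM]; under eq_bigr do rewrite mulrBl.
by rewrite sumrB uM -mulr_sumr u1 mulr1 subrr.
Qed.

(** On the manifold the shifted levels [c i] have mean zero, and none of them
    vanishes because [M] is not an integer. *)
Lemma manifold_Omega u : M \isn't a Num.int -> manifold M u -> Omega M u.
Proof.
move=> MZ uM; have [u1 _] := uM; have cu := shifted_moment uM.
have c0 i : c i != 0.
  by rewrite subr_eq0; apply: contraNneq MZ => <-; rewrite intr_int.
have u_gt0 : 0 < \sum_i sqnorm u i by rewrite u1.
split.
  have := sum_lt0_gt0 c0 (sqnorm_ge0 u) u_gt0 cu.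
  by under eq_bigl do rewrite subr_lt0.
have : 0 < \sum_(i | - c i < 0) sqnorm u i.
  apply: (@sum_lt0_gt0 _ _ (fun i => - c i)) => // [i|i|].
  - by rewrite oppr_eq0.
  - exact: sqnorm_ge0.
  - by under eq_bigr do rewrite mulNr; rewrite sumrN cu oppr0.
by under eq_bigl do rewrite oppr_lt0 subr_gt0.
Qed.

Lemma class_C_sqnorm k (U : set bv) i : open U ->
  class_C k U ((@sqnorm R F n)^~ i).
Proof.
move=> oU; apply: class_C_sum => // j.
rewrite (_ : (fun w => _) = fun w : bv => w i j * w i j); last first.
  by apply/funext => w; rewrite expr2.
by apply: class_CM => //; exact: class_C_coord.
Qed.

Lemma open_Omega : open (@Omega R F n M).
Proof.
have o (P : pred I) : open [set w : bv | 0 < \sum_(i | P i) sqnorm w i].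
  pose f (w : bv) : R := \sum_(i | P i) sqnorm w i.
  apply: (@open_comp _ _ f [set x | 0 < x]).
    move=> w _; suff : class_C 0 setT f by apply.
    apply: class_C_sum => [|i]; first exact: openT.
    by apply: class_C_sqnorm; exact: openT.
  exact: open_gt.
exact: openI (o (fun i => (lvl i)%:~R < M)) (o (fun i => M < (lvl i)%:~R)).
Qed.

Lemma smooth_multiplier : smooth_open (Omega M) (@multiplier R F n M).
Proof.
move=> k; apply: (@class_C_root _ _ _ c (fun i w => sqnorm w i)).
- exact: open_Omega.
- by move=> i k'; apply: class_C_sqnorm; exact: open_Omega.
- by move=> w; exact: Omega_admissible.
- exact: multiplierP.
Qed.

Definition log_mass w := ln (expsum c (sqnorm w) (multiplier M w)).

(** The closed form of [psi] on [Omega]. *)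
Definition psi_exp w : bv :=
  \matrix_(i, j) (exp_scaling M w (multiplier M w) i * w i j).

Lemma psiE w : Omega M w -> psi M w = psi_exp w.
Proof. by move=> Ow; apply/matrixP => i j; rewrite !mxE scalingE. Qed.

Lemma smooth_mass :
  smooth_open (Omega M) (fun w => expsum c (sqnorm w) (multiplier M w)).
Proof.
move=> k; apply: (@class_C_expsum _ _ _ c _ open_Omega k
  (fun i w => sqnorm w i)).
  by move=> i; apply: class_C_sqnorm; exact: open_Omega.
exact: smooth_multiplier.
Qed.

Lemma smooth_log_mass : smooth_open (Omega M) log_mass.
Proof.
move=> k; apply: class_C_ln; [exact: open_Omega| |exact: smooth_mass].
by move=> w Ow; exact/expsum_gt0/Omega_admissible.
Qed.

Lemma smooth_exp_scaling i :
  smooth_open (Omega M) (fun w => exp_scaling M w (multiplier M w) i).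
Proof.
move=> k; have oO := open_Omega; apply: class_C_expR => //.
apply: class_CM => //; last exact: class_C_cst.
rewrite (_ : (fun w => _) = fun w => c i * multiplier M w + (-1) * log_mass w).
  apply: class_CD => //; apply: class_CM => //; try exact: class_C_cst.
    exact: smooth_multiplier.
  exact: smooth_log_mass.
by apply/funext => w; rewrite mulN1r.
Qed.

Lemma smooth_psi_exp : smooth_open (Omega M) psi_exp.
Proof.
move=> k; have oO := open_Omega; apply: class_C_mx => // i j.
by apply: class_CM => //; [exact: smooth_exp_scaling|exact: class_C_coord].
Qed.

Lemma multiplier_manifold u : Omega M u -> manifold M u -> multiplier M u = 0.
Proof.
move=> Ou uM; apply: multiplier_unique => //.
rewrite -[RHS](shifted_moment uM); apply: eq_bigr => i _.
by rewrite mulr0 expR0 mulr1.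
Qed.

Lemma exp_scaling_manifold u i : Omega M u -> manifold M u ->
  exp_scaling M u (multiplier M u) i = 1.
Proof.
move=> Ou uM; rewrite multiplier_manifold// /exp_scaling mulr0 /expsum.
under eq_bigr do rewrite mulr0 expR0 mulr1.
by have [-> _] := uM; rewrite ln1 subrr mul0r expR0.
Qed.

Lemma is_derive_sqnorm w h i :
  is_derive w h ((@sqnorm R F n)^~ i) (2 * bdot w h i).
Proof.
rewrite mulr_sumr; apply: is_derive_sum_seq => j.
have dwj := is_derive_coord w h i j.
rewrite (_ : (fun v => _) = (fun v : bv => v i j : R) ^+ 2); last first.
  by apply/funext => v; rewrite exprfctE.
apply: is_derive_eq; rewrite expr1 /GRing.scale/=; ring.
Qed.

(** The numerator of the derivative of the root at [0] is
    [\sum_i c i * 2 * bdot u h i], a combination of the two equations defining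
    the tangent space. *)
Lemma derive_multiplier_tangent u h : Omega M u -> manifold M u ->
  tangent u h -> 'D_h (multiplier M) u = 0.
Proof.
move=> Ou uM [h1 h2].
have [||_ ->] := @derive_root _ _ _ c (fun i w => sqnorm w i) _
  (@multiplier R F n M) open_Omega _ _ (@multiplierP R F n M) u h Ou.
- by move=> i k; apply: class_C_sqnorm; exact: open_Omega.
- by move=> w; exact: Omega_admissible.
rewrite multiplier_manifold// /dexpsum [X in - X](_ : _ = 0) ?oppr0 ?mul0r//.
transitivity (2 * (\sum_i (lvl i)%:~R * bdot u h i - M * \sum_i bdot u h i)).
  rewrite mulr_sumr -sumrB mulr_sumr; apply: eq_bigr => i _.
  rewrite (@derive_val _ _ _ _ _ _ _ (is_derive_sqnorm u h i)) mulr0 expR0.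
  by rewrite /shifted_lvl; ring.
by rewrite h1 h2 mulr0 subrr mulr0.
Qed.

(** The root is stationary along [h], so only the weights contribute, and their
    total variation [2 * \sum_i bdot u h i] is zero. *)
Lemma derive_log_mass_tangent u h : Omega M u -> manifold M u ->
  tangent u h -> 'D_h log_mass u = 0.
Proof.
move=> Ou uM uh; have [h1 _] := uh; have m0 := multiplier_manifold Ou uM.
have dm : is_derive u h (@multiplier R F n M) 0.
  rewrite -(derive_multiplier_tangent Ou uM uh).
  exact: smooth_is_derive smooth_multiplier Ou.
have dS : is_derive u h (fun w => expsum c (sqnorm w) (multiplier M w)) 0.
  have <- : \sum_i (2 * bdot u h i) = 0 by rewrite -mulr_sumr h1 mulr0.
  apply: is_derive_sum_seq => i.
  have [de De] : differentiable (expR \o (c i *: @multiplier R F n M)) u /\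
      'D_h (expR \o (c i *: @multiplier R F n M)) u =
        0 * expR (c i * multiplier M u).
    have dc : is_derive u h (c i *: @multiplier R F n M) 0.
      by rewrite -[0](scaler0 _ (c i)); exact: is_deriveZ.
    rewrite -(@derive_val _ _ _ _ _ _ _ dc); apply: derive_comp1.
    apply: differentiableZ.
    exact: smooth_differentiable smooth_multiplier Ou.
  have De' : is_derive u h _ _ := derivableP (diff_derivable de).
  apply: is_derive_eq (is_deriveM (is_derive_sqnorm u h i) De') _.
  rewrite De mul0r scaler0 add0r /= !fctE m0 scaler0.
  by rewrite expR0 scale1r.
have Se : expsum c (sqnorm u) (multiplier M u) = 1.
  rewrite m0 /expsum; under eq_bigr do rewrite mulr0 expR0 mulr1.
  by have [-> _] := uM.
have S0 : 0 < expsum c (sqnorm u) (multiplier M u) by rewrite Se.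
have dS' : differentiable (fun w => expsum c (sqnorm w) (multiplier M w)) u.
  exact: smooth_differentiable smooth_mass Ou.
have [_] := derive_comp1 h dS' (is_derive1_ln S0).
by rewrite (@derive_val _ _ _ _ _ _ _ dS) mul0r.
Qed.

Lemma derive_exp_scaling_tangent u h i : Omega M u -> manifold M u ->
  tangent u h -> 'D_h (fun w => exp_scaling M w (multiplier M w) i) u = 0.
Proof.
move=> Ou uM uh.
have dm := smooth_is_derive h smooth_multiplier Ou.
have dl := smooth_is_derive h smooth_log_mass Ou.
rewrite derive_multiplier_tangent// in dm.
rewrite derive_log_mass_tangent// in dl.
pose f : bv -> R := 2^-1 *: (c i *: @multiplier R F n M - log_mass).
have df : is_derive u h f 0.
  by apply: is_derive_eq; rewrite scaler0 subr0 scaler0.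
have df' : differentiable f u.
  apply: differentiableZ; apply: differentiableB.
    apply: differentiableZ.
    exact: smooth_differentiable smooth_multiplier Ou.
  exact: smooth_differentiable smooth_log_mass Ou.
have [_] := derive_comp1 h df' (is_derive_expR (f u)).
rewrite (@derive_val _ _ _ _ _ _ _ df) mul0r => <-; congr ('D_h _ u).
apply/funext => w; rewrite /exp_scaling /f /log_mass /=.
by rewrite !fctE /GRing.scale/= mulrC.
Qed.

Lemma derive_psi_tangent u h : Omega M u -> manifold M u ->
  tangent u h -> 'D_h psi_exp u = h.
Proof.
move=> Ou uM uh.
have dpsi : derivable psi_exp u h.
  by apply: diff_derivable; exact: smooth_differentiable smooth_psi_exp Ou.
rewrite derive_mx//; apply/matrixP => i j; rewrite mxE.
have ds := smooth_is_derive h (smooth_exp_scaling i) Ou.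
rewrite derive_exp_scaling_tangent// in ds.
have dp := is_deriveM ds (is_derive_coord u h i j).
rewrite (_ : (fun w => _) = (fun w => exp_scaling M w (multiplier M w) i) *
   (fun w : bv => w i j)); last by apply/funext => w; rewrite mxE.
rewrite (@derive_val _ _ _ _ _ _ _ dp) scaler0 addr0.
by rewrite exp_scaling_manifold// scale1r.
Qed.

(** The retraction is [psi \o pair_sum]; a linear map in between reduces
    smoothness on pairs to smoothness of [psi] on [Omega]. *)
Definition pair_sum (p : bv * bv) : bv := p.1 + p.2.

Lemma pair_sum_linear : linear pair_sum.
Proof. by move=> a p q; rewrite /pair_sum /= scalerDr addrACA. Qed.

HB.instance Definition _ :=
  GRing.isLinear.Build R (bv * bv)%type bv *:%R pair_sum pair_sum_linear.

Lemma continuous_pair_sum : continuous pair_sum.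
Proof. by move=> p; apply: cvgD; [exact: cvg_fst|exact: cvg_snd]. Qed.

Lemma orth_retr_retraction : M \isn't a Num.int ->
  is_retraction (@manifold R F n M) (@tangent R F n) (@retr_dom R F n M)
    (@orth_retr R F n M).
Proof.
move=> MZ; have oO := open_Omega.
split=> [|u uM|||u uM].
- exists (pair_sum @^-1` Omega M) => //.
  by apply: open_comp => // p _; exact: continuous_pair_sum.
- split; last by rewrite addr0; exact: manifold_Omega.
  split=> //; split; rewrite big1// => i _; rewrite /bdot big1 ?mulr0// => j _;
    by rewrite mxE mulr0.
- split=> [u xi [_ Oux]|p [_ Op]]; first exact: psi_manifold.
  exists (pair_sum @^-1` Omega M), (psi_exp \o pair_sum); split=> //.
  + by apply: open_comp => // q _; exact: continuous_pair_sum.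
  + move=> k; apply: class_C_comp_linear; first exact: continuous_pair_sum.
    exact: smooth_psi_exp.
  + by move=> q Oq _; exact: psiE.
- move=> u uM; rewrite /orth_retr addr0; have Ou := manifold_Omega MZ uM.
  rewrite psiE//; apply/matrixP => i j; rewrite mxE.
  by rewrite exp_scaling_manifold// mul1r.
have Ou := manifold_Omega MZ uM.
have dpsi : differentiable psi_exp u := smooth_differentiable smooth_psi_exp Ou.
move=> e e0; have := differentiable_epsilon dpsi e0.
have : \forall h \near (0 : bv), Omega M (h + u).
  have : \forall h \near u, Omega M h by exact: open_nbhs_nbhs.
  by rewrite (near_shift 0) /= subr0.
rewrite /within /= => Oh; apply: filterS2 Oh => h Oh dh uh.
rewrite /orth_retr add0r addr0 (addrC u h) !psiE//.
have := derive_psi_tangent Ou uM uh; rewrite deriveE// => dE.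
by rewrite -[X in _ - X]dE.
Qed.

End Retraction.

Theorem lemma6p5 (R : realType) (F n : nat) (M : R)
    (hF : (1 <= F)%N) (hn0 : (0 < n)%N) (hn : ~~ odd n)
    (hM0 : 0 <= M) (hMF : M < F%:R) (hMZ : M \isn't a Num.int) :
  (forall u xi : bvec R F n, retr_dom M (u, xi) ->
     exists! s : 'I_(2 * F).+1 -> R, is_scaling M (u + xi) s) /\
  is_retraction (@manifold R F n M) (@tangent R F n) (@retr_dom R F n M)
    (@orth_retr R F n M).
Proof.
split=> [u xi [_ Ouxi]|]; last exact: orth_retr_retraction.
exists (exp_scaling M (u + xi) (multiplier M (u + xi))); split.
  exact/is_scaling_unique.
by move=> s /(is_scaling_unique _ Ouxi).
Qed.
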